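(* Suppose that $f$ is differentiable on $\mathcal H$ and $\nabla f$ is $(1/\beta_f)$-Lipschitz, where $\beta_f>0$. Let $\gamma\in(0,2\beta_V)$, let $\alpha:=\frac{2\beta_V}{4\beta_V-\gamma}$, let $\varepsilon\in(0,1)$, and suppose that $(\lambda_j)_{j\ge0}\subseteq\left(0,\frac{(1-\varepsilon)(1+\varepsilon\alpha)}{\alpha}\right)$. Suppose that $\underline\tau:=\inf_{j\ge0}\{(1-\alpha\lambda_j)\lambda_j/\alpha\}>0$ and that $\underline\lambda:=\inf_{j\ge0}\lambda_j>0$. Let $z^0\in\mathcal H$, let $(z^j)_{j\ge0}$ be generated by the FDRS iteration $z^{k+1}=T_{\lambda_k}(z^k)$, let $z^*$ be a fixed point of $T$, and let $x^*:=P_Vz^*$. Then, as $k\to\infty$, $$\min_{0\le j\le k}\left(f(x_h^j)+h(x_h^j)-f(x^* )-h(x^* )\right)=o\left(\frac1{k+1}\right).$$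
   Context: $\mathcal H$ is a real Hilbert space with identity map $I$; $V\subseteq\mathcal H$ is a closed vector subspace; $P_V,P_{V^\perp}$ are the orthogonal projections onto $V$ and $V^\perp$; $\chi_V$ is the indicator function of $V$ ($0$ on $V$, $+\infty$ elsewhere), so $\partial\chi_V(x)=V^\perp$ for $x\in V$ and $\emptyset$ otherwise. Standing assumptions: $f,g:\mathcal H\to(-\infty,\infty]$ are closed, proper and convex; $g$ is differentiable on $\mathcal H$ and $\nabla g$ is $(1/\beta)$-Lipschitz, $\beta>0$; $h:=g\circ P_V$, so $\nabla h=P_V\circ\nabla g\circ P_V$, and $\beta_V>0$ is such that $\nabla h$ is $(1/\beta_V)$-Lipschitz; there exists $x$ with $0\in\partial f(x)+\nabla g(x)+\partial\chi_V(x)$. For $\gamma>0$: $\mathrm{prox}_{\gamma f}(x):=\arg\min_{y}\left(f(y)+\frac1{2\gamma}\|y-x\|^2\right)$, $\mathrm{refl}_{\gamma f}:=2\,\mathrm{prox}_{\gamma f}-I$, $\mathrm{refl}_{\chi_V}:=2P_V-I$. The FDRS operator is $T:=\left(\frac12I+\frac12\mathrm{refl}_{\gamma f}\circ\mathrm{refl}_{\chi_V}\right)\circ(I-\gamma\nabla h)$, and $T_\lambda:=(1-\lambda)I+\lambda T$. The FDRS iteration from $z^0\in\mathcal H$ with relaxation parameters $(\lambda_j)_{j\ge0}$ is $z^{k+1}=T_{\lambda_k}(z^k)$, $k\ge0$. For each $k$: $x_h^k:=P_Vz^k$. *)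

(* Defs.v *)
From HB Require Import structures.
From mathcomp Require Import all_boot all_order all_algebra.
From mathcomp Require Import all_classical all_reals all_analysis.

Set Implicit Arguments.
Unset Strict Implicit.
Unset Printing Implicit Defensive.

Import Order.TTheory GRing.Theory Num.Theory.
Import numFieldNormedType.Exports.

Local Open Scope classical_set_scope.
Local Open Scope ring_scope.

(* A real Hilbert space is a complete normed module [H] over [R : realType]
   together with [dot : {dot H for idfun}] (a symmetric, positive definite
   bilinear form) such that [inner_norm dot] holds. *)
Section Hilbert.
Context {R : realType} {H : completeNormedModType R}.

Definition inner_norm (dot : {dot H for idfun}) : Prop :=
  forall x, dot x x = `|x| ^+ 2.

Definition closed_subspace (V : set H) : Prop :=
  closed V /\ submod_closed [in V].

Definition indicator (V : set H) (x : H) : \bar R :=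
  if x \in V then 0%E else +oo%E.

(* The value [-oo] of [\bar R] is excluded: proper functions map into
   (-oo, +oo] and are finite somewhere. *)
Definition proper_fun (f : H -> \bar R) : Prop :=
  (forall x, f x != -oo%E) /\ exists x, f x \is a fin_num.

(* For proper [f] no [+oo - oo] occurs here, and [0 * +oo = 0] in [\bar R],
   so the cases [t = 0] and [t = 1] are trivial. *)
Definition convex_fun (f : H -> \bar R) : Prop :=
  forall (x y : H) (t : R), 0 <= t <= 1 ->
    (f (t *: x + (1 - t) *: y)%R
       <= t%:E * f x + (1 - t)%:E * f y)%E.

Definition closed_proper_convex (f : H -> \bar R) : Prop :=
  [/\ lower_semicontinuous f, proper_fun f & convex_fun f].

(* An extended-real-valued function which is differentiable on the whole
   space is in particular finite everywhere; [differentiable] is Frechet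
   differentiability. *)
Definition ediff (f : H -> \bar R) : Prop :=
  (forall x, f x \is a fin_num) /\
  (forall x, differentiable (fine \o f : H -> R^o) x).

Definition argmin (f : H -> \bar R) : set H :=
  [set y | forall w, (f y <= f w)%E].

Definition prox (gamma : R) (f : H -> \bar R) (x : H) : H :=
  xget 0 (argmin (fun y => f y + ((2 * gamma)^-1 * `|y - x| ^+ 2)%:E)%E).

Definition prox_refl (gamma : R) (f : H -> \bar R) (x : H) : H :=
  2 *: prox gamma f x - x.

Variable dot : {dot H for idfun}.

Definition subdiff (f : H -> \bar R) (x : H) : set H :=
  [set u | forall y, (f x + (dot u (y - x))%:E <= f y)%E].

(* The Riesz representative of the differential; the default value 0 is
   irrelevant where [f] is differentiable. *)
Definition grad (f : H -> \bar R) (x : H) : H :=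
  xget 0 [set v | forall u, 'd (fine \o f : H -> R^o) x u = dot v u].

Definition orthocomp (V : set H) : set H :=
  [set x | forall v, V v -> dot x v = 0].

Definition orth_proj (V : set H) (x : H) : H :=
  xget 0 [set y | V y /\ orthocomp V (x - y)].

Definition orth_refl (V : set H) (x : H) : H := 2 *: orth_proj V x - x.

Definition fdrs_op (gamma : R) (f h : H -> \bar R) (V : set H) (x : H) : H :=
  let y := x - gamma *: grad h x in
  2^-1 *: y + 2^-1 *: prox_refl gamma f (orth_refl V y).

Definition relaxed (lambda : R) (T : H -> H) (x : H) : H :=
  (1 - lambda) *: x + lambda *: T x.

End Hilbert.

(* Main.v *)
Require Import Defs.
From HB Require Import structures.
From mathcomp Require Import all_boot all_order all_algebra.
From mathcomp Require Import all_classical all_reals all_analysis.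
From mathcomp Require Import ring lra.

Set Implicit Arguments.
Unset Strict Implicit.
Unset Printing Implicit Defensive.

Import Order.TTheory GRing.Theory Num.Theory.
Import numFieldNormedType.Exports.

Local Open Scope classical_set_scope.
Local Open Scope ring_scope.

(** Write [P] for the projection onto [V], [F] and [Q] for the finite values of
    [f] and [h], and [r = T z - z]. Unfolding the operator shows that the
    proximal point computed inside [T z] is [P z + r]; its optimality condition
    reads
      [gamma * grad f (P z + r) = P z - z - gamma * grad h z - r]  ([fdrs_step]).
    Together with the convexity of [F] and [Q] and the quadratic upper bounds
    coming from their Lipschitz gradients, this identity carries the proof.

    Monotonicity of [grad f] and the Baillon-Haddad inequality for [grad h] give
      [dot (z - zs) r <= - (1 - gamma / (4 betaV)) |r|^2]  ([step_averaged]),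
    which says that [T] is [alpha]-averaged with respect to the fixed point [zs];
    a relaxed step therefore lowers [|z - zs|^2] by a fixed multiple of [|r|^2]
    ([fejer_step]).

    The gradient of [f] is controlled at [P z + r], whereas the gap evaluates
    [f] at [P z]; smoothness of [f] makes the change of point cost only
    [|r|^2 / (2 betaf)]. What is left of the gap is
    [- gamma^-1 * dot r (P z - xs)], and along a relaxed step this is a
    difference of consecutive values of [|P z - xs|^2], again up to a multiple
    of [|r|^2] ([gap_le_telescoping]).

    Adding to [|P z - xs|^2 / (2 gamma)] a large multiple of [|z - zs|^2] absorbs
    all the [|r|^2] terms and yields a nonnegative Lyapunov function whose
    decrease dominates the gap ([gap_le_lyapunov]). The gap is nonnegative,
    because [xs] minimizes [f + h] over [V] ([gap_ge0]), so it is summable. Its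
    running minimum over the first [k + 1] indices is repeated about [k / 2]
    times in the tail of the series, hence is [o(1 / (k + 1))]
    ([bigmin_littleo]).

    Projections, gradients (that is, Riesz representatives) and proximal points
    are picked by a choice operator, so their existence has to be shown; all
    three are minimizers provided by [min_proximal]. *)

(** * Existence of minimizers *)

(** The estimate [c |x - y|^2 <= (phi x + phi y) / 2 - inf phi] forces every
    minimizing sequence to be Cauchy, which replaces compactness. *)
Lemma min_uniformly_convex (R : realType) (H : completeNormedModType R)
    (A : set H) (phi : H -> R) (c m : R) :
  closed A -> A !=set0 -> continuous (phi : H -> R^o) -> 0 < c ->
  (forall x, A x -> m <= phi x) ->
  (forall x y, A x -> A y -> A (2^-1 *: (x + y))) ->
  (forall x y, A x -> A y ->
     phi (2^-1 *: (x + y)) + c * `|x - y| ^+ 2 <= 2^-1 * (phi x + phi y)) ->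
  exists2 x, A x & forall y, A y -> phi x <= phi y.
Proof.
move=> clA [x0 Ax0] phic c0 phim Amid phiuc.
pose E := phi @` A; pose s := inf E.
have Elb : has_lbound E by exists m => _ [x Ax <-]; exact: phim.
have hE : has_inf E by split => //; exists (phi x0); exists x0.
have sle y : A y -> s <= phi y by move=> Ay; apply: ge_inf => //; exists y.
have /choice[u uP] : forall n : nat, exists x, A x /\ phi x < s + n.+1%:R^-1.
  move=> n; have n0 : 0 < n.+1%:R^-1 :> R by rewrite invr_gt0.
  by have [_ [x Ax <-] ltx] := inf_adherent n0 hE; exists x.
have uA n : A (u n) by have [] := uP n.
have small n : phi (u n) <= s + n.+1%:R^-1 by have [_ /ltW] := uP n.
have gapN N n : (N <= n)%N -> c * `|u N - u n| ^+ 2 <= N.+1%:R^-1.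
  move=> Nn; have := phiuc _ _ (uA N) (uA n).
  (* The value at the midpoint is at least the infimum. *)
  have := sle _ (Amid _ _ (uA N) (uA n)).
  have : n.+1%:R^-1 <= N.+1%:R^-1 :> R by rewrite lef_pV2 ?posrE// ler_nat.
  have := small N; have := small n.
  move: n.+1%:R^-1 N.+1%:R^-1 => p q; lra.
have invN e : 0 < e -> exists N, forall n, (N <= n)%N -> n.+1%:R^-1 < e :> R.
  move=> e0.
  exists (Num.truncn e^-1).+1 => n Nn; rewrite invf_plt ?posrE//.
  apply: (lt_le_trans (truncnS_gt _)); rewrite ler_nat.
  exact: leq_trans Nn (leqnSn _).
have cvu : cvgn u.
  apply/cauchy_cvgP/cauchy_exP => e e0.
  have [N HN] := invN (c * e ^+ 2) (mulr_gt0 c0 (exprn_gt0 2 e0)).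
  exists (u N); exists N => // n Nn; rewrite -ball_normE /=.
  have := le_lt_trans (gapN _ _ Nn) (HN _ (leqnn N)).
  by rewrite ltr_pM2l// ltr_pXn2r// ?nnegrE// ltW.
have Al : A (limn u).
  exact: (closed_cvg A clA (nearW _ uA) _ cvu).
exists (limn u) => // y Ay; apply: le_trans (sle _ Ay).
have cphi : phi (u n) @[n --> \oo] --> (phi (limn u) : R^o).
  by apply: (cvg_comp _ _ cvu); exact: phic.
apply/ler_addgt0Pr => e e0.
apply: (cvgr_to_le cphi); have [N HN] := invN _ e0.
exists N => // n /= Nn; apply: (le_trans (small n)).
by rewrite lerD2l ltW// HN.
Qed.

(** * Inner product and the Riesz theorem *)

Section Hilbert.
Context {R : realType} {H : completeNormedModType R}.
Variables (dot : {dot H for idfun}).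
Hypothesis hdot : inner_norm dot.
Implicit Types (x y u v w : H) (a b c t L : R).

Lemma dotC x y : dot x y = dot y x.
Proof. by rewrite hermC expr0 mul1r. Qed.

Lemma dotDl x y u : dot (x + y) u = dot x u + dot y u.
Proof. exact: linearDl. Qed.

Lemma dotNl x u : dot (- x) u = - dot x u.
Proof. exact: linearNl. Qed.

Lemma dotZl a x u : dot (a *: x) u = a * dot x u.
Proof. exact: linearZl_LR. Qed.

Lemma dotDr x y u : dot u (x + y) = dot u x + dot u y.
Proof. by rewrite dotC dotDl !(dotC u). Qed.

Lemma dotNr x u : dot u (- x) = - dot u x.
Proof. by rewrite dotC dotNl dotC. Qed.

Lemma dotZr a x u : dot u (a *: x) = a * dot u x.
Proof. by rewrite dotC dotZl dotC. Qed.

Definition dotE := (dotDl, dotDr, dotNl, dotNr, dotZl, dotZr).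

Lemma dot_ge0 x : 0 <= dot x x.
Proof. by rewrite hdot sqr_ge0. Qed.

Lemma dot_eq0 x : dot x x <= 0 -> x = 0.
Proof.
move=> x0; apply/eqP; rewrite -normr_eq0 -sqrf_eq0 -hdot.
by rewrite eq_le x0 dot_ge0.
Qed.

Lemma dot_inj x y : (forall u, dot x u = dot y u) -> x = y.
Proof.
by move=> xy; apply/subr0_eq/dot_eq0; rewrite dotDl dotNl xy subrr.
Qed.

Lemma cauchy_schwarz x y : dot x y <= `|x| * `|y|.
Proof.
have [->|x0] := eqVneq x 0; first by rewrite linear0l normr0 mul0r.
have [->|y0] := eqVneq y 0; first by rewrite dotC linear0l normr0 mulr0.
have xy : 0 < `|x| * `|y| by rewrite mulr_gt0 ?normr_gt0.
rewrite -(ler_pM2l xy); have := dot_ge0 (`|y| *: x - `|x| *: y).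
rewrite !dotE (dotC y x) !hdot; lra.
Qed.

(** By the parallelogram law the quadratic term supplies the uniform convexity
    that [min_uniformly_convex] asks for. The cases of interest are [F = 0]
    (projection onto [A]), [F] linear (Riesz representation) and [F] convex on
    the whole space (proximal point). *)
Lemma min_proximal (A : set H) (F : H -> R) (k m : R) (x : H) :
  closed A -> A !=set0 -> continuous (F : H -> R^o) -> 0 < k ->
  (forall y, A y -> m <= F y + k * `|y - x| ^+ 2) ->
  (forall y w, A y -> A w -> A (2^-1 *: (y + w))) ->
  (forall y w, F (2^-1 *: (y + w)) <= 2^-1 * (F y + F w)) ->
  exists2 p, A p &
    forall y, A y -> F p + k * `|p - x| ^+ 2 <= F y + k * `|y - x| ^+ 2.
Proof.
move=> clA A0 Fc k0 Fm Amid Fmid.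
apply: (@min_uniformly_convex _ _ A _ (k / 4) m) => //.
- move=> y; apply: cvgD; first exact: Fc.
  apply: cvgM; first exact: cvg_cst.
  apply: cvgM; apply: cvg_norm; apply: cvgB => //; exact: cvg_cst.
- by rewrite divr_gt0.
- move=> y w Ay Aw; have := Fmid y w; set mid := _ *: _.
  rewrite -!hdot /mid !dotE !(dotC w y) !(dotC x y) !(dotC x w); lra.
Qed.

(** First-order optimality: the linear term of a parabola that is minimal at the
    origin vanishes. *)
Lemma quadratic_ge0_lin0 b c : 0 <= c ->
  (forall t, 0 <= 2 * t * b + t ^+ 2 * c) -> b = 0.
Proof.
(* Minimizing over [t] would take [- b / c]; the shift handles [c = 0]. *)
move=> c0 /(_ (- b / (c + 1))).
have c1 : 0 < c + 1 by lra.
have -> : 2 * (- b / (c + 1)) * b + (- b / (c + 1)) ^+ 2 * c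
   = - (b ^+ 2 * ((c + 2) / (c + 1) ^+ 2)).
  by field; rewrite gt_eqF.
rewrite oppr_ge0 pmulr_lle0; last by rewrite divr_gt0 ?exprn_gt0//; lra.
by move=> b0; apply/eqP; rewrite -sqrf_eq0 eq_le b0 sqr_ge0.
Qed.

(** The representing vector is the minimizer of [|v|^2 - 2 l v]. *)
Lemma riesz (l : {linear H -> R^o}) :
  continuous l -> exists v, forall u, l u = dot v u.
Proof.
move=> lc; have [M M0 lM] := linear_lipschitz lc.
have [|||||||v _ vmin] := @min_proximal setT (fun v => - (2 * l v)) 1 (- M ^+ 2) 0.
- exact: closedT.
- by exists 0.
- by move=> y; apply: cvgN; apply: cvgM; [exact: cvg_cst | exact: lc].
- exact: ltr01.
- move=> y _; rewrite subr0 mul1r.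
  have := le_trans (ler_norm _) (lM y); have := sqr_ge0 (`|y| - M).
  rewrite !expr2; lra.
- by [].
- move=> y w.
  have -> : l (2^-1 *: (y + w)) = 2^-1 * (l y + l w) by rewrite linearZ linearD.
  lra.
exists v => u; apply/esym/subr0_eq.
apply: (@quadratic_ge0_lin0 _ (dot u u)); first exact: dot_ge0.
move=> t; have := vmin (v + t *: u) I.
have -> : l (v + t *: u) = l v + t * l u by rewrite linearD linearZ.
rewrite !subr0 -!hdot !dotE (dotC u v); lra.
Qed.

(** * Convex functions with Lipschitz gradient *)

Lemma gradP (f : H -> \bar R) x : differentiable (fine \o f : H -> R^o) x ->
  forall u, 'd (fine \o f : H -> R^o) x u = dot (grad dot f x) u.
Proof.
move=> df; have [v vP] := riesz (diff_continuous df).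
by rewrite /grad; case: xgetP => [w -> //|/(_ v)/(_ vP)].
Qed.

Definition subgrad_map (F : H -> R) (G : H -> H) :=
  forall x y, F x + dot (G x) (y - x) <= F y.

Definition quad_upper_bound L (F : H -> R) (G : H -> H) :=
  forall x y, F y <= F x + dot (G x) (y - x) + L / 2 * `|y - x| ^+ 2.

Lemma ediff_line_derive (f : H -> \bar R) x v t : ediff f ->
  is_derive t (1 : R) (fun s : R => fine (f (x + s *: v)) : R^o)
    (dot (grad dot f (x + t *: v)) v).
Proof.
move=> [_ df].
have dl : is_diff t (fun s : R => x + s *: v) ( *:%R ^~ v).
  by apply: is_diff_eq; rewrite add0r.
have dc := is_diff_comp dl (differentiableP (df (x + t *: v))).
have dF : differentiable (fun s : R => fine (f (x + s *: v)) : R^o) t.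
  exact: (ex_diff (is_diff_def := dc)).
apply: DeriveDef; first exact/derivable1_diffP.
rewrite deriveE// (diff_val (is_diff_def := dc)) /= scale1r gradP //.
Qed.

Lemma convex_fineE (f : H -> \bar R) (x y : H) (t : R) :
  (forall x, f x \is a fin_num) -> convex_fun f -> 0 <= t <= 1 ->
  fine (f (t *: x + (1 - t) *: y)) <= t * fine (f x) + (1 - t) * fine (f y).
Proof.
move=> ff cf t01; rewrite -lee_fin EFinD !EFinM !fineK//; exact: cf.
Qed.

(** For [0 < t <= 1] convexity bounds the difference quotient along [y - x] by
    [f y - f x]; the gradient term is its limit as [t] tends to [0]. *)
Lemma convex_subgrad_map (f : H -> \bar R) :
  convex_fun f -> ediff f -> subgrad_map (fine \o f) (grad dot f).
Proof.
move=> cf df x y; have [ff _] := df.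
have [+ +] := ediff_line_derive x (y - x) 0 df.
rewrite scale0r addr0 => dv <-.
rewrite -lerBrDl; apply: (cvgr_to_le (cvg_dnbhs_at_right dv)).
near=> t.
have t0 : 0 < t by [].
have t1 : t <= 1 by near: t; exact: nbhs_right_le.
rewrite /= addr0 scale0r addr0 /GRing.scale/= mulr1 mulrC ler_pdivrMr//.
have -> : x + t *: (y - x) = t *: y + (1 - t) *: x.
  by rewrite scalerBr scalerBl scale1r addrC addrAC -addrA.
have := @convex_fineE f y x t ff cf; rewrite (ltW t0) t1 => /(_ isT); lra.
Unshelve. all: by end_near. Qed.

Lemma is_derive_quadratic a b t :
  is_derive t (1 : R) (fun s : R => s * a + s ^+ 2 * b : R^o) (a + 2 * t * b).
Proof.
have D : is_derive t (1 : R) (id * cst a + id ^+ 2 * cst b : R -> R^o) _ :=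
  is_deriveD
    (is_deriveM (is_derive_id _ _) (is_derive_cst _ _ _))
    (is_deriveM (is_deriveX _ (is_derive_id _ _)) (is_derive_cst _ _ _)).
by apply: (is_derive_eq D); rewrite /cst /GRing.scale/= fctE; ring.
Qed.

(** The sharp constant [L / 2] matters: it makes the co-coercivity constant
    exactly [1 / L]. It comes from the mean value theorem applied to [f] along
    the segment minus its quadratic model, whose derivative is nonpositive. *)
Lemma lipschitz_quad_upper_bound (f : H -> \bar R) L :
  0 <= L -> ediff f -> L.-lipschitz (grad dot f) ->
  quad_upper_bound L (fine \o f) (grad dot f).
Proof.
move=> L0 df lip x y; set v := y - x.
pose q (s : R) : R := fine (f (x + s *: v)) - (s * dot (grad dot f x) v
   + s ^+ 2 * (L / 2 * `|v| ^+ 2)).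
pose dq (s : R) : R := dot (grad dot f (x + s *: v)) v - (dot (grad dot f x) v
   + (2 * s) * (L / 2 * `|v| ^+ 2)).
have qd (s : R) : is_derive s (1 : R) (q : R -> R^o) (dq s).
  apply: (@is_deriveB _ R^o R^o); first exact: ediff_line_derive.
  exact: is_derive_quadratic.
have [|c c01] := @MVT_segment R q dq 0 1 ler01 (fun s _ => qd s).
  apply: continuous_subspaceT => s.
  by apply: differentiable_continuous; apply/derivable1_diffP; case: (qd s).
have dq0 : dq c <= 0.
  have c0 : 0 <= c by move: c01; rewrite in_itv/= => /andP[].
  have : `|grad dot f (x + c *: v) - grad dot f x| <= L * (c * `|v|).
    have := lip (x + c *: v, x) (conj I I).
    by rewrite /= [x + _]addrC addrK normrZ ger0_norm.
  rewrite /dq; move: (grad dot f (x + c *: v)) (grad dot f x) => Gc G0 /(ler_wpM2r (normr_ge0 v)).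
  have := cauchy_schwarz (Gc - G0) v; rewrite dotDl dotNl; lra.
rewrite subr0 mulr1 => qE; move: dq0; rewrite -qE /q.
rewrite scale1r scale0r addr0 /v subrKC -/v /=; lra.
Qed.

Lemma subgrad_map_monotone (F : H -> R) (G : H -> H) x y :
  subgrad_map F G -> 0 <= dot (G x - G y) (x - y).
Proof. move=> FG; have := FG x y; have := FG y x; rewrite !dotE; lra. Qed.

(** Co-coercivity of the gradient. Evaluating the quadratic upper bound at [v]
    and the subgradient inequality at [u] in the point [v + b (G u - G v)], where
    their difference is extremal, improves the subgradient inequality by
    [b / 2 |G u - G v|^2]; exchanging the points and adding gives the claim. *)
Lemma baillon_haddad (F : H -> R) (G : H -> H) b x y : 0 < b ->
  subgrad_map F G -> quad_upper_bound b^-1 F G ->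
  b * `|G x - G y| ^+ 2 <= dot (G x - G y) (x - y).
Proof.
move=> b0 low up.
have half u v : F u + dot (G u) (v - u) + b / 2 * `|G u - G v| ^+ 2 <= F v.
  have := low u (v + b *: (G u - G v)); have := up v (v + b *: (G u - G v)).
  rewrite [v + _ - v]addrAC subrr add0r normrZ exprMn gtr0_norm//.
  have -> : b^-1 / 2 * (b ^+ 2 * `|G u - G v| ^+ 2) = b / 2 * `|G u - G v| ^+ 2.
    by field; rewrite gt_eqF.
  rewrite -hdot !dotE (dotC (G v) (G u)); lra.
have := half x y; have := half y x; rewrite (distrC (G y)) !dotE; lra.
Qed.

Lemma dot_quad_ge u w k : 0 < k ->
  - (`|u| ^+ 2 / (4 * k)) <= dot u w + k * `|w| ^+ 2.
Proof.
move=> k0; have k4 : 0 < 4 * k by rewrite mulr_gt0.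
rewrite -subr_ge0 -(pmulr_rge0 _ k4).
have := dot_ge0 (u + (2 * k) *: w); rewrite !dotE (dotC w u) !hdot.
rewrite mulrDr mulrN mulrN opprK (mulrC _ (_ / _)) divfK ?gt_eqF//; lra.
Qed.

(** The proximal point exists since the subgradient inequality bounds the
    objective from below. For its optimality condition it is enough to compare
    with a step of length [s] against [e], the gradient of the objective: the
    quadratic upper bound rules out [e <> 0] when [s] is small. *)
Lemma prox_grad (f : H -> \bar R) gamma L x : 0 < gamma -> 0 <= L ->
  convex_fun f -> ediff f -> quad_upper_bound L (fine \o f) (grad dot f) ->
  gamma *: grad dot f (prox gamma f x) = x - prox gamma f x.
Proof.
move=> g0 L0 cf df up; have [ff dff] := df.
have low := convex_subgrad_map cf df.
pose F := fine \o f; pose k := (2 * gamma)^-1.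
have k0 : 0 < k by rewrite invr_gt0 mulr_gt0.
have [||||||p _ pmin] :=
  @min_proximal setT F k (F x - `|grad dot f x| ^+ 2 / (4 * k)) x closedT.
- by exists 0.
- by move=> y; exact: differentiable_continuous.
- exact: k0.
- move=> y _; have := low x y; have := dot_quad_ge (grad dot f x) (y - x) k0.
  rewrite -/F; lra.
- by [].
- move=> y w.
  have -> : 2^-1 *: (y + w) = 2^-1 *: y + (1 - 2^-1) *: w.
    by rewrite scalerDr; congr (_ + _ *: _); lra.
  apply: le_trans (convex_fineE _ _ ff cf _) _; first by lra.
  rewrite /F /=; lra.
have := @xgetPex _ 0 (argmin (fun y =>
    f y + ((2 * gamma)^-1 * `|y - x| ^+ 2)%:E)%E).
have ex : exists p, argmin (fun y =>
    f y + ((2 * gamma)^-1 * `|y - x| ^+ 2)%:E)%E p.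
  exists p => w; rewrite -(fineK (ff p)) -(fineK (ff w)) lee_fin; exact: pmin.
move=> /(_ ex); rewrite -/(prox gamma f x); set q := prox gamma f x => qmin.
have {}qmin w : F q + k * `|q - x| ^+ 2 <= F w + k * `|w - x| ^+ 2.
  have : (f q + (k * `|q - x| ^+ 2)%:E <= f w + (k * `|w - x| ^+ 2)%:E)%E.
    exact: qmin.
  by rewrite -(fineK (ff q)) -(fineK (ff w)) lee_fin.
pose e := grad dot f q + (2 * k) *: (q - x).
suff e0 : e = 0.
  have -> : grad dot f q = gamma^-1 *: (x - q).
    apply: subr0_eq; rewrite -[RHS]e0 /e /k -[q - x]opprB scalerN; congr (_ - _ *: _).
    by field; rewrite gt_eqF.
  by rewrite scalerA divff ?scale1r// gt_eqF.
apply: dot_eq0.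
(* The inverse of the smoothness constant of the whole objective. *)
pose s := (L + 2 * k)^-1.
have Lk0 : 0 < L + 2 * k by lra.
have s0 : 0 < s by rewrite invr_gt0.
have := qmin (q - s *: e); have := up q (q - s *: e).
rewrite -/F -!hdot [q - _ - q]addrAC subrr add0r.
rewrite [q - _ - x]addrAC.
have -> : dot (q - x - s *: e) (q - x - s *: e)
   = dot (q - x) (q - x) - 2 * s * dot (q - x) e + s ^+ 2 * dot e e.
  rewrite dotDl !(dotDr _ (- (s *: e))) !(dotNl, dotNr, dotZl, dotZr) (dotC e); ring.
rewrite dotNr dotNl dotNr !dotZl !dotZr => h1 h2.
have : s * dot e e <= (L / 2 + k) * (s ^+ 2 * dot e e).
  have : s * dot e e = s * (dot (grad dot f q) e + 2 * k * dot (q - x) e).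
    by rewrite -(dotZl (2 * k)) -dotDl.
  lra.
have -> : (L / 2 + k) * (s ^+ 2 * dot e e) = s * (dot e e / 2).
  rewrite /s; field; rewrite gt_eqF//.
by rewrite ler_pM2l//; lra.
Qed.

(** * Projection onto a closed subspace *)

Section Projection.
Variable V : set H.
Hypothesis hV : closed_subspace V.
Local Notation P := (orth_proj dot V).

Lemma subspace0 : V 0.
Proof. by case: hV => _ [] /=; rewrite inE. Qed.

Lemma subspace_lin a u v : V u -> V v -> V (a *: u + v).
Proof.
by move=> Vu Vv; case: hV => _ [_ /(_ a u v)] /=; rewrite !inE; apply.
Qed.

Lemma orth_projP x : V (P x) /\ (forall v, V v -> dot (x - P x) v = 0).
Proof.
have [clV _] := hV.
have [||||||p Vp pmin] := @min_proximal V (fun=> 0) 1 0 x clV.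
- by exists 0; exact: subspace0.
- exact: cst_continuous.
- exact: ltr01.
- by move=> y _; rewrite add0r mul1r sqr_ge0.
- move=> y w Vy Vw; rewrite -[_ *: _]addr0; apply: subspace_lin subspace0.
  by rewrite -[y]scale1r; exact: subspace_lin.
- by move=> *; rewrite addr0 mulr0.
have ex : exists p, [set y | V y /\ orthocomp dot V (x - y)] p.
  exists p; split=> // v Vv.
  apply: (@quadratic_ge0_lin0 _ (dot v v)); first exact: dot_ge0.
  move=> t; have := pmin (- t *: v + p) (subspace_lin _ Vv Vp).
  rewrite -!hdot !dotE !(dotC x) (dotC p v); lra.
exact: (xgetPex 0 ex).
Qed.

Lemma orth_proj_unique x p : V p -> (forall v, V v -> dot (x - p) v = 0) ->
  P x = p.
Proof.
move=> Vp op; have [VP oP] := orth_projP x.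
have Vd : V (P x - p) by rewrite addrC -scaleN1r; exact: subspace_lin.
apply/subr0_eq/dot_eq0.
have := op _ Vd; have := oP _ Vd; rewrite !(dotDl, dotNl); lra.
Qed.

Lemma orth_proj_id x : V x -> P x = x.
Proof. by move=> Vx; apply: orth_proj_unique => // v _; rewrite subrr linear0l. Qed.

Lemma orth_proj_linear : linear P.
Proof.
move=> a x y; have [Vx ox] := orth_projP x; have [Vy oy] := orth_projP y.
apply: orth_proj_unique; first exact: subspace_lin.
move=> v Vv; have := ox v Vv; have := oy v Vv.
by rewrite !dotE => /eqP; rewrite subr_eq0 => /eqP -> /eqP;
  rewrite subr_eq0 => /eqP ->; rewrite subrr.
Qed.

Lemma dot_orth_proj x v : V v -> dot (P x) v = dot x v.
Proof.
by move=> Vv; have [_ /(_ v Vv)] := orth_projP x; rewrite dotDl dotNl; lra.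
Qed.

Lemma dot_orth_projC x y : dot (P x) y = dot x (P y).
Proof.
have [Vx _] := orth_projP x; have [Vy _] := orth_projP y.
by rewrite dotC -(dot_orth_proj y Vx) dotC dot_orth_proj.
Qed.

Lemma orth_proj_norm x : dot (P x) (P x) <= dot x x.
Proof.
have [VP /(_ _ VP)] := orth_projP x; have := dot_ge0 (x - P x).
rewrite !dotE (dotC (P x) x); lra.
Qed.

Lemma orth_projB x y : P (x - y) = P x - P y.
Proof. by rewrite addrC -scaleN1r orth_proj_linear scaleN1r addrC. Qed.

(** The projection bundled as a linear map, so that the theory of linear maps
    applies to it. *)
Definition orth_proj_fun : {linear H -> H} :=
  HB.pack P (GRing.isLinear.Build _ _ _ _ _ orth_proj_linear).

Lemma orth_proj_continuous : continuous P.
Proof.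
apply: (@bounded_linear_continuous _ _ _ orth_proj_fun).
apply/linear_boundedP; near=> r => x.
apply: (@le_trans _ _ `|x|).
  by rewrite -ler_sqr ?nnegrE// -!hdot; exact: orth_proj_norm.
rewrite -[leLHS]mul1r ler_wpM2r//; near: r; exact: nbhs_pinfty_ge.
Unshelve. all: by end_near. Qed.

Lemma orth_proj_differentiable x : differentiable P x.
Proof. exact: (@linear_differentiable _ _ _ orth_proj_fun _ orth_proj_continuous). Qed.

Lemma ediff_comp_proj (g : H -> \bar R) : ediff g -> ediff (g \o P).
Proof.
move=> [fg dg]; split=> x; first exact: fg.
exact: (differentiable_comp (orth_proj_differentiable x) (dg (P x))).
Qed.

Lemma convex_comp_proj (g : H -> \bar R) : convex_fun g -> convex_fun (g \o P).
Proof.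
move=> cg x y t t01 /=.
have -> : P (t *: x + (1 - t) *: y) = t *: P x + (1 - t) *: P y.
  by rewrite -[P]/(orth_proj_fun : H -> H) linearD !linearZ_LR.
exact: cg.
Qed.

(** * The fixed-point operator of the splitting *)

(** Here [p] is the projection of [w = z - zs], [r = T z - z] and [d] is the
    difference of the gradients of the forward step. Monotonicity gives
    [dot w r <= - |r|^2 - c (dot d p + dot d r)]; co-coercivity bounds [dot d p]
    below by [b |d|^2], and completing the square in [2 b d + r] leaves
    [c / (4 b) |r|^2]. *)
Lemma averaged_of_monotone (p w r d : H) c b : 0 < c -> 0 < b ->
  dot w p = dot p p ->
  0 <= dot (p - w - c *: d - r) (p + r) -> b * `|d| ^+ 2 <= dot d p ->
  dot w r <= - (1 - c / (4 * b)) * `|r| ^+ 2.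
Proof.
move=> c0 b0 wp; rewrite -!hdot !(dotDl, dotNl, dotZl) !dotDr wp (dotC r p).
move: (dot p p) (dot p r) (dot w r) (dot d p) => pp pr wr dp mono coco.
have q0 : 0 < c / (4 * b) by rewrite divr_gt0 ?mulr_gt0.
have := mulr_ge0 (ltW q0) (dot_ge0 ((2 * b) *: d + r)).
rewrite dotDl !(dotDr _ r) !(dotZl, dotZr) (dotC r d).
move: (dot d d) (dot d r) (dot r r) coco mono => dd dr rr coco mono.
have -> : c / (4 * b) * (2 * b * (2 * b * dd) + 2 * b * dr
    + (2 * b * dr + rr)) = c * (b * dd + dr) + c / (4 * b) * rr.
  by field; rewrite gt_eqF.
move: (c / (4 * b)) => q; have := ler_wpM2l (ltW c0) coco; lra.
Qed.

(** The analysis needs only the following data: two convex functions [F] and [Q]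
    with gradients [Gf] and [Gq], the latter with values in [V], and an operator
    [T] whose step satisfies the optimality condition [T_step]. *)
Section Splitting.
Variables (F Q : H -> R) (Gf Gq : H -> H) (T : H -> H) (gamma betaf betaq : R).
Hypotheses (gamma0 : 0 < gamma) (betaf0 : 0 < betaf) (betaq0 : 0 < betaq).
Hypotheses (lowF : subgrad_map F Gf) (upF : quad_upper_bound betaf^-1 F Gf).
Hypotheses (lowQ : subgrad_map Q Gq) (upQ : quad_upper_bound betaq^-1 Q Gq).
Hypothesis Gq_proj : forall z, P (Gq z) = Gq z.
Hypothesis T_step : forall z, gamma *: Gf (P z + (T z - z)) =
  P z - z - gamma *: Gq z - (T z - z).
Variable zs : H.
Hypothesis zs_fixed : T zs = zs.
Local Notation xs := (P zs).
Local Notation gap z := (F (P z) + Q z - F xs - Q zs).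

Lemma dot_Gq_proj z u : dot (Gq z) (P u) = dot (Gq z) u.
Proof. by rewrite -dot_orth_projC Gq_proj. Qed.

Lemma grad_fixed : gamma *: Gf xs = xs - zs - gamma *: Gq zs.
Proof. by have := T_step zs; rewrite zs_fixed subrr subr0 addr0. Qed.

Lemma step_averaged z :
  dot (z - zs) (T z - z) <= - (1 - gamma / (4 * betaq)) * `|T z - z| ^+ 2.
Proof.
have coco := baillon_haddad z zs betaq0 lowQ upQ.
have mono := subgrad_map_monotone (P z + (T z - z)) xs lowF.
have := mulr_ge0 (ltW gamma0) mono; rewrite -dotZl scalerBr T_step grad_fixed.
have wP : dot (z - zs) (P (z - zs)) = dot (P (z - zs)) (P (z - zs)).
  by apply/esym/dot_orth_proj; case: (orth_projP (z - zs)).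
have dP : dot (Gq z - Gq zs) (z - zs) = dot (Gq z - Gq zs) (P (z - zs)).
  by rewrite dotDl [RHS]dotDl !dotNl !dot_Gq_proj.
move: coco; rewrite dP; move: wP; rewrite orth_projB => wP coco mon.
apply: (averaged_of_monotone gamma0 betaq0 wP _ coco).
move: mon.
move: (T z) (P z) (P zs) (Gq z) (Gq zs) => t p ps d ds.
set u := (X in dot X _); set v := (X in dot _ X) => uv.
set u' := (X in dot X _); set v' := (X in dot _ X).
have -> : u' = u by apply: dot_inj => e; rewrite /u /u' !dotE; ring.
by have -> : v' = v by apply: dot_inj => e; rewrite /v /v' !dotE; ring.
Qed.

(** By [grad_fixed] the sum of the two gradients at the fixed point is
    [(P zs - zs) / gamma], which is orthogonal to [V]: this is the optimality of
    [P zs] over [V]. *)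
Lemma gap_ge0 z : 0 <= gap z.
Proof.
have := lowF xs (P z); have := lowQ zs z.
have : dot (Gf xs) (P z - xs) + dot (Gq zs) (z - zs) = 0.
  have [_ os] := orth_projP zs.
  rewrite -[dot (Gq zs) _]dot_Gq_proj -orth_projB.
  apply: (mulfI (lt0r_neq0 gamma0)); rewrite mulr0 mulrDr -!dotZl -dotDl.
  rewrite grad_fixed subrK -opprB dotNl os ?oppr0//.
  by case: (orth_projP (z - zs)).
lra.
Qed.

(** The subgradient inequality is used at [P z + (T z - z)], the only point where
    [T_step] identifies [Gf]; the upper bound for [F] brings the value back to
    [P z]. In the sum of both gradients the part [P z - z] is orthogonal to [V],
    so only the step remains. *)
Lemma gap_le_step z : gap z <=
  - (gamma^-1 * dot (T z - z) (P z - xs)) + (2 * betaf)^-1 * `|T z - z| ^+ 2.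
Proof.
have up := upF (P z + (T z - z)) (P z); have low := lowF (P z + (T z - z)) xs.
have lowq := lowQ z zs; have st := T_step z.
have Gf_eq : dot (Gf (P z + (T z - z))) (P z - xs) + dot (Gq z) (z - zs) =
    - (gamma^-1 * dot (T z - z) (P z - xs)).
  have [_ oz] := orth_projP z.
  have Va : V (P z - xs) by rewrite -orth_projB; case: (orth_projP (z - zs)).
  rewrite -[dot (Gq z) _]dot_Gq_proj orth_projB.
  apply: (mulfI (lt0r_neq0 gamma0)).
  rewrite mulrN (mulrA gamma) divff ?lt0r_neq0// mul1r.
  rewrite mulrDr -!dotZl st -dotDl addrAC subrK -(opprB z (P z)).
  by rewrite (dotDl (- _)) !dotNl oz// oppr0 add0r.
have rE : `|P z - (P z + (T z - z))| = `|T z - z|.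
  by rewrite opprD addrA subrr sub0r normrN.
move: up low lowq Gf_eq; rewrite rE.
have -> : betaf^-1 / 2 = (2 * betaf)^-1 by rewrite invfM mulrC.
move: (T z - z) (P z) (P zs) => r p ps.
move: (Gf (p + r)) => G; rewrite !(dotDr, dotNr); lra.
Qed.

Section Step.
Variables (z zn : H) (t : R).
Hypotheses (t0 : 0 < t) (znE : zn = z + t *: (T z - z)).

(** Expand the square. The factor [2 - gamma / (2 betaq)] is [1 / alpha], where
    [alpha] is the averagedness constant of [T]. *)
Lemma fejer_step : `|zn - zs| ^+ 2 <=
  `|z - zs| ^+ 2 - t * (2 - gamma / (2 * betaq) - t) * `|T z - z| ^+ 2.
Proof.
have := ler_wpM2l (ltW t0) (step_averaged z).
have -> : zn - zs = (z - zs) + t *: (T z - z) by rewrite znE addrAC.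
have -> : gamma / (2 * betaq) = 2 * (gamma / (4 * betaq)).
  by field; rewrite gt_eqF.
move: (T z - z) (z - zs) (gamma / _) => r w q.
rewrite -!hdot !dotE (dotC r w); lra.
Qed.

(** Multiplying the gap by [t] turns [t (T z - z)] into the displacement
    [zn - z]; polarization then writes its inner product with [P z - xs] as a
    difference of squares, at the price of [t^2 |T z - z|^2]. *)
Lemma gap_le_telescoping : t * gap z <=
  (`|P z - xs| ^+ 2 - `|P zn - xs| ^+ 2) / (2 * gamma)
  + (t ^+ 2 / (2 * gamma) + t / (2 * betaf)) * `|T z - z| ^+ 2.
Proof.
have := ler_wpM2l (ltW t0) (gap_le_step z).
have -> : P zn - xs = (P z - xs) + t *: P (T z - z).
  rewrite znE -[P]/(orth_proj_fun : H -> H).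
  by rewrite linearD linearZ_LR /= addrAC.
have Pr := orth_proj_norm (T z - z).
have Va : V (P z - xs) by rewrite -orth_projB; case: (orth_projP (z - zs)).
rewrite -(dot_orth_proj _ Va).
have -> : (2 * gamma)^-1 = gamma^-1 / 2 by rewrite invfM mulrC.
have g1 : 0 <= gamma^-1 * t ^+ 2 by rewrite mulr_ge0 ?invr_ge0 ?ltW ?exprn_gt0.
have := ler_wpM2l g1 Pr.
rewrite -!hdot; move: (P (T z - z)) (P z - xs) => p a.
move: (dot (T z - z) _) => rr.
rewrite !dotE (dotC a p).
move: (_ - _ - _) => gp; move: (2 * betaf)^-1 gamma^-1 => bi gi.
lra.
Qed.

(** The weight of [|x - zs|^2] is the bound on the error coefficients in
    [gap_le_telescoping] divided by [tau], the guaranteed decrease in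
    [fejer_step]; the factor [lmin^-1] removes the relaxation parameter in front
    of the gap. *)
Definition lyapunov (lmin lmax tau : R) x : R :=
  lmin^-1 * (`|P x - xs| ^+ 2 / (2 * gamma)
    + (lmax ^+ 2 / (2 * gamma) + lmax / (2 * betaf)) / tau * `|x - zs| ^+ 2).

Lemma lyapunov_ge0 lmin lmax tau x : 0 < lmin -> 0 < lmax -> 0 < tau ->
  0 <= lyapunov lmin lmax tau x.
Proof.
move=> lmin0 lmax0 tau0.
by rewrite mulr_ge0 ?addr_ge0 ?mulr_ge0 ?addr_ge0 ?mulr_ge0 ?invr_ge0
  ?mulr_ge0 ?sqr_ge0// ltW.
Qed.

Lemma gap_le_lyapunov lmin lmax tau : 0 < lmin -> 0 < tau ->
  lmin <= t -> t <= lmax -> tau <= t * (2 - gamma / (2 * betaq) - t) ->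
  gap z + lyapunov lmin lmax tau zn <= lyapunov lmin lmax tau z.
Proof.
move=> lmin0 tau0 lmin_t t_lmax tau_t.
have lgap : lmin * gap z <= t * gap z by rewrite ler_wpM2r// gap_ge0.
have := fejer_step; have := gap_le_telescoping; have := ler_wpM2r (sqr_ge0 `|T z - z|) tau_t.
rewrite /lyapunov.
have lmax0 : 0 < lmax by exact: lt_le_trans t_lmax.
have g2 : 0 <= (2 * gamma)^-1 by rewrite invr_ge0 ltW ?mulr_gt0.
have b2 : 0 <= (2 * betaf)^-1 by rewrite invr_ge0 ltW ?mulr_gt0.
have : 0 <= lmax ^+ 2 / (2 * gamma) + lmax / (2 * betaf).
  by rewrite addr_ge0 ?mulr_ge0 ?sqr_ge0 ?(ltW lmax0).
have : t ^+ 2 / (2 * gamma) + t / (2 * betaf) <=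
    lmax ^+ 2 / (2 * gamma) + lmax / (2 * betaf).
  by rewrite lerD ?ler_wpM2r// lerXn2r// nnegrE ltW.
move: (t ^+ 2 / (2 * gamma) + t / (2 * betaf)) (lmax ^+ 2 / _ + _) => c C.
move: (sqr_ge0 `|T z - z|) lgap.
move: (`|T z - z| ^+ 2) (`|P z - xs| ^+ 2) (`|P zn - xs| ^+ 2) (`|z - zs| ^+ 2)
  (`|zn - zs| ^+ 2) (gap z) (2 * gamma)^-1 => rho a a' d d' G gi.
move: (t * (2 - _ - t)) => mu rho0 lgap cC C0 tau_rho tele fejer.
rewrite -(ler_pM2l lmin0) mulrDr !mulrA divff ?lt0r_neq0// !mul1r.
have Crho := ler_wpM2r rho0 cC.
have Ct : 0 <= C / tau by rewrite divr_ge0// ltW.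
have := ler_wpM2l Ct (le_trans tau_rho (_ : mu * rho <= d - d')).
rewrite [_ * (tau * rho)]mulrA divfK ?lt0r_neq0// => /(_ ltac:(lra)).
lra.
Qed.
End Step.
End Splitting.

(** * The forward-Douglas-Rachford operator *)

Section Instance.
Variables (f h : H -> \bar R) (gamma L : R).
Hypotheses (gamma0 : 0 < gamma) (L0 : 0 <= L) (cf : convex_fun f) (df : ediff f).
Hypothesis lipf : L.-lipschitz (grad dot f).
Hypothesis grad_proj : forall z, P (grad dot h z) = grad dot h z.
Local Notation T := (fdrs_op dot gamma f h V).

(** The gradient lies in [V], so projecting the shifted point keeps the shift and
    the two halves of the operator cancel except for one projection. *)
Lemma fdrs_opE z :
  T z = z + (prox gamma f (2 *: P z - z - gamma *: grad dot h z) - P z).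
Proof.
rewrite /fdrs_op /prox_refl /orth_refl; set y := z - _.
have Py : P y = P z - gamma *: grad dot h z.
  rewrite /y orth_projB; congr (_ - _).
  by rewrite -[P]/(orth_proj_fun : H -> H) linearZ_LR /= grad_proj.
have -> : 2 *: P y - y = 2 *: P z - z - gamma *: grad dot h z.
  rewrite Py /y; move: (P z) (grad dot h z) => p d.
  by apply: dot_inj => u; rewrite !dotE; ring.
rewrite /y; move: (prox _ _ _) => q; move: (P z) (grad dot h z) => p d.
by apply: dot_inj => u; rewrite !dotE; field.
Qed.

Lemma fdrs_step z : gamma *: grad dot f (P z + (T z - z)) =
  P z - z - gamma *: grad dot h z - (T z - z).
Proof.
have up := lipschitz_quad_upper_bound L0 df lipf.
rewrite fdrs_opE; set y := 2 *: P z - z - _.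
have -> : P z + (z + (prox gamma f y - P z) - z) = prox gamma f y.
  by rewrite [z + _]addrC addrK addrC subrK.
rewrite (prox_grad _ gamma0 L0 cf df up).
rewrite /y; move: (prox _ _ _) => q; move: (P z) (grad dot h z) => p d.
by apply: dot_inj => u; rewrite !dotE; ring.
Qed.
End Instance.

(** The composite is constant along the orthogonal complement of [V]. Moving in
    the direction [e] of the component of the gradient in that complement, the
    subgradient inequality gives [|e|^2 <= 0]. *)
Lemma grad_comp_proj (g : H -> \bar R) z : convex_fun g -> ediff g ->
  P (grad dot (g \o P) z) = grad dot (g \o P) z.
Proof.
move=> cg dg.
have low : subgrad_map (fine \o (g \o P)) (grad dot (g \o P)).
  by apply: convex_subgrad_map; [exact: convex_comp_proj|exact: ediff_comp_proj].
set d := grad _ _ z; set e := d - P d.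
have [Vd od] := orth_projP d.
have Pe : P e = 0 by rewrite orth_projB (orth_proj_id Vd) subrr.
have Pze : P (z + e) = P z.
  by rewrite -[P]/(orth_proj_fun : H -> H) linearD /= Pe addr0.
have := low z (z + e); rewrite /= Pze -/d [z + e]addrC addrK.
have de : dot d e = dot e e by rewrite {3}/e dotDl dotNl (dotC (P d)) od// subr0.
by rewrite de gerDl => /dot_eq0 /subr0_eq.
Qed.
End Projection.
End Hilbert.

(** * Rates and the theorem *)

(** An unbounded family has infimum [0] by convention, so a positive infimum is a
    genuine lower bound. *)
Lemma inf_gt0_le (R : realType) (I : Type) (a : I -> R) i :
  0 < inf (range a) -> inf (range a) <= a i.
Proof.
move=> a0; apply: ge_inf; last by exists i.
have [[_ //]|/inf_out a_eq0] := pselect (has_inf (range a)).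
by rewrite a_eq0 ltxx in a0.
Qed.

(** Summability is expressed by a nonnegative [W] whose decrease dominates [u].
    Choosing [N] with [W N] close to the limit, the running minimum is at most
    each of the [k + 1 - N >= (k + 1) / 2] values in the tail, whose sum is at
    most [W N - lim W]. *)
Lemma bigmin_littleo (R : realType) (u W : nat -> R) :
  (forall k, 0 <= u k) -> (forall k, 0 <= W k) ->
  (forall k, u k + W k.+1 <= W k) ->
  (fun k : nat => \big[Order.min/u 0%N]_(j < k.+1) u j : R^o)
    =o_\oo (fun k : nat => (k.+1%:R)^-1 : R^o).
Proof.
move=> u0 W0 uW; apply/eqoP => e e0.
have hW : has_inf (range W).
  by split; [exists (W 0%N); exists 0%N | exists 0 => _ [k _ <-]].
have e2 : 0 < e / 2 by rewrite divr_gt0.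
have [_ [N _ <-] WN] := inf_adherent e2 hW.
have Winf k : inf (range W) <= W k.
  by apply: ge_inf; [case: hW | exists k].
(* Beyond [2 N] at least half of the indices lie in the tail. *)
exists (2 * N)%N => // k /= Nk.
set m := \big[_/_]_(_ < _) _.
have m_le j : (j <= k)%N -> m <= u j.
  by rewrite -ltnS => jk; exact: (@bigmin_le _ _ _ _ (Ordinal jk)).
have m0 : 0 <= m by apply: le_bigmin.
have tail n : (N + n <= k.+1)%N -> n%:R * m + W (N + n)%N <= W N.
  elim: n => [|n IHn] Nn; first by rewrite mul0r add0r addn0.
  have lt_Nn : (N + n < k.+1)%N by rewrite -addnS.
  have := IHn (ltnW lt_Nn); have := uW (N + n)%N; have := m_le (N + n)%N lt_Nn.
  rewrite addnS -[n.+1%:R]natr1; lra.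
have Nk1 : (N <= k.+1)%N.
  by apply: leq_trans (leqnSn k); apply: leq_trans Nk; rewrite leq_pmull.
have := tail (k.+1 - N)%N; rewrite subnKC// => /(_ (leqnn _)).
have half : k.+1%:R <= 2 * (k.+1 - N)%:R :> R.
  rewrite -natrM ler_nat mulnBr leq_subRL; last by rewrite leq_mul2l Nk1 orbT.
  by rewrite [(2 * k.+1)%N]mul2n -addnn leq_add2r (leq_trans Nk).
have := ler_wpM2r m0 half; have := Winf k.+1 => Wk km tl.
rewrite !ger0_norm// ?invr_ge0// ler_pdivlMr// mulrC; lra.
Qed.

Theorem theorem5p2 (R : realType) (H : completeNormedModType R)
  (dot : {dot H for idfun}) (hdot : inner_norm dot)
  (V : set H) (hV : closed_subspace V)
  (f g : H -> \bar R)
  (hf : closed_proper_convex f) (hg : closed_proper_convex g)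
  (beta : R) (hbeta : 0 < beta)
  (dg : ediff g) (lipg : (beta^-1).-lipschitz (grad dot g))
  (h := g \o orth_proj dot V)
  (betaV : R) (hbetaV : 0 < betaV)
  (liph : (betaV^-1).-lipschitz (grad dot h))
  (hsol : exists x : H,
     [set u + grad dot g x + v | u in subdiff dot f x
                               & v in subdiff dot (indicator V) x] 0)
  (betaf : R) (hbetaf : 0 < betaf)
  (df : ediff f) (lipf : (betaf^-1).-lipschitz (grad dot f))
  (gamma : R) (hgamma : 0 < gamma < 2 * betaV)
  (alpha := 2 * betaV / (4 * betaV - gamma))
  (eps : R) (heps : 0 < eps < 1)
  (lambda : nat -> R)
  (hlambda : forall j,
     0 < lambda j < (1 - eps) * (1 + eps * alpha) / alpha)
  (htau : 0 < inf (range (fun j => (1 - alpha * lambda j) * lambda j / alpha)))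
  (hinf : 0 < inf (range lambda))
  (T := fdrs_op dot gamma f h V)
  (z : nat -> H) (hz : forall k, z k.+1 = relaxed (lambda k) T (z k))
  (zs : H) (hzs : T zs = zs)
  (xs := orth_proj dot V zs)
  (xh := fun k => orth_proj dot V (z k))
  (gap := fun j => fine (f (xh j) + h (xh j) - f xs - h xs)%E) :
  (fun k : nat => \big[Order.min/gap 0%N]_(j < k.+1) gap j : R^o)
    =o_\oo (fun k : nat => (k.+1%:R)^-1 : R^o).
Proof.
have [_ _ cf] := hf; have [_ _ cg] := hg.
have [ff _] := df; have [fg _] := dg.
have [gamma0 gamma_lt] := andP hgamma.
have dh : ediff h by exact: ediff_comp_proj.
have ch : convex_fun h by exact: convex_comp_proj.
have grad_hV x : orth_proj dot V (grad dot h x) = grad dot h x.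
  exact: grad_comp_proj.
have betaf1 : 0 <= betaf^-1 by rewrite invr_ge0 ltW.
have betaV1 : 0 <= betaV^-1 by rewrite invr_ge0 ltW.
have lowF := convex_subgrad_map hdot cf df.
have upF := lipschitz_quad_upper_bound hdot betaf1 df lipf.
have lowQ := convex_subgrad_map hdot ch dh.
have upQ := lipschitz_quad_upper_bound hdot betaV1 dh liph.
have step := fdrs_step hdot hV gamma0 betaf1 cf df lipf grad_hV.
pose tau := inf (range (fun j => (1 - alpha * lambda j) * lambda j / alpha)).
have lambda_ge j : inf (range lambda) <= lambda j by exact: inf_gt0_le.
have lambda0 j : 0 < lambda j by exact: lt_le_trans (lambda_ge j).
have tau_le j : tau <= lambda j * (2 - gamma / (2 * betaV) - lambda j).
  apply: (le_trans (inf_gt0_le j htau)); rewrite le_eqVlt; apply/orP; left.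
  by apply/eqP; rewrite /alpha; field; rewrite !gt_eqF//=; lra.
(* A positive decrease in [fejer_step] already forces [lambda j < 2]. *)
have lambda_le j : lambda j <= 2.
  have := lt_le_trans htau (tau_le j); rewrite pmulr_rgt0//.
  have : 0 < gamma / (2 * betaV) by rewrite divr_gt0 ?mulr_gt0.
  lra.
have znE k : z k.+1 = z k + lambda k *: (T (z k) - z k).
  rewrite hz /relaxed; move: (T (z k)) => t.
  by rewrite scalerBl scale1r scalerBr addrAC -addrA.
(* Since [h] factors through the projection, its value at [x_h] is its value at
   [z]; the subgradient inequality for [h] can thus be used at [z] itself. *)
have gapE j : gap j = fine (f (xh j)) + fine (h (z j)) - fine (f xs) - fine (h zs).
  have PP x : orth_proj dot V (orth_proj dot V x) = orth_proj dot V x.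
    by apply: orth_proj_id => //; case: (orth_projP hdot hV x).
  rewrite /gap /h /xh /xs /= !PP.
  by rewrite -(fineK (ff _)) -(fineK (fg _)) -(fineK (ff (orth_proj dot V zs)))
    -(fineK (fg (orth_proj dot V zs))).
apply: (@bigmin_littleo _ _ (fun k =>
  lyapunov dot V gamma betaf zs (inf (range lambda)) 2 tau (z k))) => k.
- rewrite gapE.
  exact: (gap_ge0 hdot hV gamma0 lowF lowQ grad_hV step hzs).
- exact: lyapunov_ge0.
- rewrite gapE.
  exact: (gap_le_lyapunov hdot hV gamma0 hbetaf hbetaV lowF upF lowQ upQ grad_hV
    step hzs (lambda0 k) (znE k) hinf htau (lambda_ge k) (lambda_le k) (tau_le k)).
Qed.
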